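(* Let $M_n=\sum_{k=1}^n\xi_k$, $n\ge1$, where $\xi_1,\xi_2,\ldots$ are independent centred normal random variables with $\operatorname{Var}(\xi_k)=\sigma_1^2>0$ for all $k$. Let $\varepsilon_1,\varepsilon_2,\ldots$ be independent centred normal random variables, independent of $\{\xi_k\}$, with $\operatorname{Var}(\varepsilon_n)=\sigma_2^2>0$ for all $n$. Define $$S_n=\beta_nM_n+\varepsilon_n,\quad n\ge1,$$ where $\{\beta_n\}$ is a nondecreasing sequence of nonnegative numbers satisfying $$(\beta_{n+1}-\beta_n)\beta_n\,n\,\sigma_1^2\ge\sigma_2^2,\quad n\ge1.$$ Then $\{S_n,\,n\ge1\}$ is a demimartingale.
   Context: Functions are understood to be Borel measurable. A sequence of $L^1$ random variables $(S_n)_{n\ge1}$ is a demimartingale if for all $j\ge1$, $E[(S_{j+1}-S_j)f(S_1,\ldots,S_j)]\ge 0$ for all componentwise nondecreasing functions $f:\mathbb{R}^j\to\mathbb{R}$ for which the expectation is defined. *)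

(* Defs.v *)
From mathcomp Require Import all_boot all_order all_algebra.
From mathcomp Require Import all_classical all_reals all_analysis.

Set Implicit Arguments.
Unset Strict Implicit.
Unset Printing Implicit Defensive.

Import Order.TTheory GRing.Theory Num.Theory.
Import numFieldNormedType.Exports.

Local Open Scope classical_set_scope.
Local Open Scope ring_scope.

Section independence.
Context {d : measure_display} {T : measurableType d} {R : realType}.
Variable P : probability T R.

(* Mutual independence of the variables [X i], [i \in I]: the product rule
   holds for every finite subfamily. *)
Definition independent_RVs {I0 : choiceType} (I : set I0)
    (X : I0 -> {RV P >-> R}) : Prop :=
  forall (s : seq I0) (A : I0 -> set R),
    uniq s -> (forall i, i \in s -> I i) ->
    (forall i, i \in s -> measurable (A i)) ->
    P (\bigcap_(i in [set` s]) (X i @^-1` A i)) =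
    (\prod_(i <- s) P (X i @^-1` A i))%E.

Definition sigma_RVs {I0 : Type} (I : set I0)
    (X : I0 -> {RV P >-> R}) : set (set T) :=
  <<s \bigcup_(i in I) preimage_set_system setT (X i) measurable >>.

(* The whole family [X] is independent of the whole family [Y]; nothing is
   said about the dependence inside each family. *)
Definition independent_families {I0 J0 : Type} (I : set I0) (J : set J0)
    (X : I0 -> {RV P >-> R}) (Y : J0 -> {RV P >-> R}) : Prop :=
  forall A B : set T, sigma_RVs I X A -> sigma_RVs J Y B ->
    P (A `&` B) = (P A * P B)%E.

End independence.

Section demimartingale.
Context {d : measure_display} {T : measurableType d} {R : realType}.
Variable P : probability T R.

(* The expectation of [X] exists in the extended reals. Integrability of [X]
   is the special case where both expectations below are finite. *)
Definition expectation_defined (X : T -> R) : Prop :=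
  ('E_P[X^\+] < +oo)%E \/ ('E_P[X^\-] < +oo)%E.

Definition componentwise_nondecreasing (j : nat) (f : j.-tuple R -> R) : Prop :=
  forall x y : j.-tuple R,
    (forall i : 'I_j, tnth x i <= tnth y i) -> f x <= f y.

(* Sequences are indexed from 1; the value [S 0] is ignored. The sigma-algebra
   of [j.-tuple R] is the product one, i.e., the Borel sigma-algebra of R^j. *)
Definition demimartingale (S : nat -> T -> R) : Prop :=
  (forall n, (1 <= n)%N -> P.-integrable setT (EFin \o S n)) /\
  (forall j, (1 <= j)%N ->
   forall f : j.-tuple R -> R,
     measurable_fun setT f -> componentwise_nondecreasing f ->
     let X := fun w => (S j.+1 w - S j w) * f [tuple S i.+1 w | i < j] in
     expectation_defined X -> (0 <= 'E_P[X])%E).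

End demimartingale.

(* Main.v *)
From HB Require Import structures.
Require Import Defs.
From mathcomp Require Import all_boot all_order all_algebra.
From mathcomp Require Import all_classical all_reals all_analysis.
From mathcomp Require Import measurable_realfun.
From mathcomp Require Import ring lra.

Set Implicit Arguments.
Unset Strict Implicit.
Unset Printing Implicit Defensive.

Import Order.TTheory GRing.Theory Num.Theory.
Import numFieldNormedType.Exports.

Local Open Scope classical_set_scope.
Local Open Scope ring_scope.

(** The proof rests on the Cameron-Martin formula. Let [X_1, ..., X_m] be
    independent centred normal variables with variances [s_i^2], and let
    [D = sum_i v_i X_i]. Weighting the law of [X] by [exp (t D - t^2 Var D / 2)]
    amounts to translating it:
<<
      E[h(X) exp (t D - t^2 Var D / 2)] = E[h(X + t c)],  c_i = Cov(X_i, D)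
>>
    for all [h >= 0] (theorem [cameron_martin]). In dimension one this is
    completing the square; for [m] variables it suffices to compare two measures
    on rectangles, where independence turns both sides into products.

    If [F >= 0] is bounded and increases along the direction [c], the formula
    gives [E[F(X) exp (t D)] >= E[F(X)]] for [t > 0]; comparing at first order
    as [t] tends to [0] gives [E[D F(X)] >= 0] ([expectation_mul_ge0]). A bounded
    [F] of any sign follows by adding a constant, because [E[D] = 0]. A general
    [F] is truncated: the truncations still increase along [c], and monotone
    convergence bounds the expectation of the negative part of [D F(X)] by that
    of its positive part ([expectation_truncate_ge0]), which is what is needed
    when the expectation is only known to exist in the extended reals. The
    result is [expectation_linform_mul_ge0].

    For the demimartingale, [X] is the vector of the [xi_k] and [eps_k] with
    [k <= j + 1], and [D = S_(j+1) - S_j]. Moving [X] by [t c] translates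
    [(S_1, ..., S_j)] by the vector of the [t Cov(S_i, D)]. For [i < j] this
    covariance is [(beta_(j+1) - beta_j) beta_i i sigma_1^2 >= 0], and for
    [i = j] it is the same expression minus [sigma_2^2], nonnegative by the
    growth condition ([walk_cov_ge0]). Hence [f(S_1, ..., S_j)] increases along
    [c] for every componentwise nondecreasing [f]. *)

(** * Measures with a density *)

Section density.
Context d (T : measurableType d) (R : realType).
Variables (mu : {measure set T -> \bar R}) (g : T -> R).
Hypotheses (g_ge0 : forall x, 0 <= g x) (mg : measurable_fun setT g).
Local Open Scope ereal_scope.

(** The measure [g mu]. The two proofs are arguments of the definition so that
    the measure structure can be attached to it. *)
Definition density_measure of (forall x, (0 <= g x)%R) & measurable_fun setT g :
    set T -> \bar R :=
  fun A => \int[mu]_(x in A) (g x)%:E.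

Local Notation nu := (density_measure g_ge0 mg).

Let nu0 : nu set0 = 0.
Proof. exact: integral_set0. Qed.

Let nu_ge0 A : 0 <= nu A.
Proof. by apply: integral_ge0 => x _; rewrite lee_fin. Qed.

Let nu_sigma_additive : semi_sigma_additive nu.
Proof.
move=> /= A mA tA mUA.
rewrite /density_measure ge0_integral_bigcup//=.
- by apply: is_cvg_ereal_nneg_natsum_cond => n _ _; exact: nu_ge0.
- by apply: (measurable_funS measurableT) => //; exact/measurable_EFinP.
- by move=> x _; rewrite lee_fin.
Qed.

HB.instance Definition _ := isMeasure.Build _ _ _ nu
  nu0 nu_ge0 nu_sigma_additive.

Import HBNNSimple.

Lemma ge0_integral_density (f : T -> \bar R) :
  (forall x, 0 <= f x) -> measurable_fun setT f ->
  \int[nu]_x f x = \int[mu]_x (f x * (g x)%:E).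
Proof.
move=> f0 mf; pose h := nnsfun_approx measurableT mf.
have mgE : measurable_fun setT (EFin \o g) by exact/measurable_EFinP.
have cvh x : EFin \o h ^~ x @ \oo --> f x by exact: cvg_nnsfun_approx.
have ndh x : {homo (fun n => h n x) : m n / (m <= n)%N >-> (m <= n)%R}.
  by move=> m n mn; exact/lefP/nd_nnsfun_approx.
transitivity (limn (fun n => \int[nu]_x (h n x)%:E)).
  rewrite -monotone_convergence//.
  - by apply: eq_integral => x _; apply/esym/cvg_lim => //; exact: cvh.
  - by move=> n; exact/measurable_EFinP.
  - by move=> n x _; rewrite lee_fin.
  - by move=> x _ m n mn; rewrite lee_fin; exact: ndh.
transitivity (limn (fun n => \int[mu]_x ((h n x)%:E * (g x)%:E))); last first.
  rewrite -monotone_convergence//.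
  - apply: eq_integral => x _; apply/cvg_lim => //.
    by apply: cvgeZr => //; exact: cvh.
  - by move=> n; apply: emeasurable_funM => //; exact/measurable_EFinP.
  - by move=> n x _; rewrite mule_ge0// lee_fin.
  - move=> x _ m n mn; rewrite lee_wpmul2r ?lee_fin//; exact: ndh.
congr (limn _); apply/funext => n.
rewrite (_ : (fun x => (h n x)%:E * (g x)%:E) = fun x =>
    \sum_(y \in range (h n)) (y * \1_(h n @^-1` [set y]) x)%:E * (g x)%:E);
    last first.
  apply/funext => x; rewrite -ge0_mule_fsuml => [|y]; last first.
    exact: nnfun_muleindic_ge0.
  by rewrite fsumEFin // -(fimfunE _ x).
under eq_integral do rewrite fimfunE -fsumEFin//.
have mind r : measurable_fun setT (fun x => (r * \1_(h n @^-1` [set r]) x)%:E).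
  by apply/measurable_EFinP; exact: measurable_funM.
rewrite ge0_integral_fsum//; last by move=> m y _; exact: nnfun_muleindic_ge0.
rewrite ge0_integral_fsum//; last 2 first.
- by move=> y; exact: emeasurable_funM.
- move=> m y _; rewrite mule_ge0 ?lee_fin//.
  by rewrite -lee_fin EFinM nnfun_muleindic_ge0.
apply: eq_fsbigr => r; rewrite inE => -[t _ htr].
have r0 : (0 <= r)%R by rewrite -htr.
under eq_integral do rewrite EFinM.
rewrite integralZl_indic_nnsfun//.
under [RHS]eq_integral do rewrite EFinM -muleA.
rewrite ge0_integralZl//=.
- rewrite integral_indic// setIT; congr (_ * _).
  transitivity (\int[mu]_(x in h n @^-1` [set r]) (g x)%:E) => //.
  rewrite integral_mkcond; apply: eq_integral => x _.
  by rewrite epatch_indic /= muleC.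
- by apply: emeasurable_funM => //; exact/measurable_EFinP.
- by move=> x _; rewrite mule_ge0// lee_fin.
Qed.

End density.

(** * Products of functions of independent variables *)

Section independent_product.
Context d (T : measurableType d) (R : realType) (P : probability T R).
Context {I0 : choiceType} (I : set I0) (X : I0 -> {RV P >-> R}).
Hypothesis indepX : independent_RVs I X.
Local Open Scope ereal_scope.

(** The product formula, by induction on the list [s] of the factors that may
    fail to be indicator functions. *)
Let independent_prod_indic (s t : seq I0) (g : I0 -> R -> R) :
  uniq t -> (forall i, i \in t -> I i) ->
  (forall i x, 0 <= g i x)%R -> (forall i, measurable_fun setT (g i)) ->
  (forall i, i \in t -> \int[P]_w (g i (X i w))%:E < +oo) ->
  (forall i, i \in t -> i \notin s ->
     exists2 A, measurable A & g i = \1_A :> (R -> R)) ->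
  \int[P]_w (\prod_(i <- t) g i (X i w))%:E =
  \prod_(i <- t) \int[P]_w (g i (X i w))%:E.
Proof.
elim: s g => [|k s IH] g ut tI g0 mg gfin gind.
  pose A i := g i @^-1` [set 1%R].
  have gA i : i \in t -> g i = \1_(A i) :> (R -> R).
    move=> it; have [//|B mB gB] := gind i it _.
    rewrite gB; congr (\1_ _); apply/seteqP; rewrite /A gB; split => x /=.
      by move=> Bx; rewrite indicE mem_set.
    by rewrite indicE; case: (asboolP (x \in B)) => [/set_mem//|/negP/negbTE->];
      move=> /esym/eqP; rewrite oner_eq0.
  have mA i : measurable (A i).
    by rewrite -[A i]setTI; exact: mg.
  have mXA i : measurable (X i @^-1` A i).
    by rewrite -[_ @^-1` _]setTI; exact: measurable_funP.
  have indXA w i : \1_(A i) (X i w) = \1_(X i @^-1` A i) w :> R by [].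
  transitivity (\int[P]_w (\1_(\bigcap_(i in [set` t]) (X i @^-1` A i)) w)%:E).
    apply: eq_integral => w _; congr EFin; rewrite bigcap_seq.
    under eq_big_seq => i it do rewrite gA// indXA.
    elim: t {ut tI gfin gind gA} => [|i t IHt].
      by rewrite !big_nil indicT.
    by rewrite !big_cons indicI/= -IHt.
  rewrite integral_indic ?setIT//; last first.
    by apply: fin_bigcap_measurable => // i _; exact: mXA.
  apply: (etrans (indepX ut tI (fun i _ => mA i))); apply: eq_big_seq => i it.
  under eq_integral do rewrite gA// indXA.
  by rewrite integral_indic// setIT.
have [kt|kt] := boolP (k \in t); last first.
  apply: IH => // i it is_; apply: gind => //; rewrite inE negb_or is_ andbT.
  by apply: contraNneq kt => <-.
rewrite (big_rem k kt)/=; set t' := rem k t.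
have t't i : i \in t' -> i \in t by exact: mem_rem.
have kt' i : i \in t' -> i != k.
  by apply: contraTneq => ->; rewrite mem_rem_uniq// inE eqxx.
pose W w : R := (\prod_(i <- t') g i (X i w))%R.
have W0 w : (0 <= W w)%R by apply: prodr_ge0.
have mW : measurable_fun setT W.
  by apply: measurable_prod => i _; exact: measurableT_comp.
pose c := \prod_(i <- t') \int[P]_w (g i (X i w))%:E.
have [r0 cE] : exists r : {nonneg R}, c = r%:num%:E.
  have: 0 <= c /\ c < +oo.
    rewrite /c; elim: t' t't {kt' W W0 mW c} => [|i t' IHt'] t't.
      by rewrite big_nil lee01 ltry.
    rewrite big_cons; have [|c0 cy] := IHt' _.
      by move=> j jt; apply: t't; rewrite inE jt orbT.
    have gi0 : 0 <= \int[P]_w (g i (X i w))%:E.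
      by apply: integral_ge0 => w _; rewrite lee_fin.
    split; first exact: mule_ge0.
    by rewrite lte_mul_pinfty// ge0_fin_numE// gfin// t't// inE eqxx.
  case: c => [r [r0 _]| []//|[]//].
  by exists (NngNum r0).
have mXk : measurable_fun setT (X k) by exact: measurable_funP.
(* Under the weight [W] of the other factors, the law of [X k] is a multiple of
   its law under [P]: on a set [B] this is the induction hypothesis, with [g k]
   replaced by the indicator of [B]. *)
have lawk B : measurable B ->
    pushforward (density_measure P W0 mW) (X k) B =
    mscale r0 (distribution P (X k)) B.
  move=> mB; pose gB i : R -> R := if i == k then \1_B else g i.
  have gBk i w : i \in t' -> gB i (X i w) = g i (X i w).
    by rewrite /gB => /kt'/negbTE ->.
  have mXB : measurable (X k @^-1` B).
    by rewrite -[_ @^-1` _]setTI; exact: measurable_funP.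
  have ikB : \int[P]_w (gB k (X k w))%:E = P (X k @^-1` B).
    by rewrite /gB eqxx -[in RHS](setIT (_ @^-1` _)) -integral_indic.
  have -> : pushforward (density_measure P W0 mW) (X k) B =
      \int[P]_w (\prod_(i <- t) gB i (X i w))%:E.
    transitivity (\int[P]_(w in X k @^-1` B) (W w)%:E) => //.
    rewrite integral_mkcond; apply: eq_integral => w _.
    rewrite epatch_indic/= -EFinM (big_rem k kt)/= mulrC /gB eqxx; congr EFin.
    by congr (_ * _)%R; apply: eq_big_seq => i /kt'/negbTE ->.
  rewrite /mscale/= -cE muleC IH//.
  - rewrite (big_rem k kt)/= ikB; congr (_ * _); apply: eq_big_seq => i it'.
    by apply: eq_integral => w _; rewrite gBk.
  - by move=> i x; rewrite /gB; case: ifP.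
  - by move=> i; rewrite /gB; case: ifP => // _; exact: measurable_indic.
  - move=> i it; have [->|ik] := eqVneq i k.
      by rewrite ikB (le_lt_trans (probability_le1 _ _))// ltry.
    by rewrite /gB (negbTE ik); exact: gfin.
  - move=> i it is_; rewrite /gB; case: eqP => [_|/eqP ik]; first by exists B.
    by apply: gind => //; rewrite inE negb_or ik.
transitivity (\int[density_measure P W0 mW]_w (g k (X k w))%:E).
  rewrite ge0_integral_density.
  - by apply: eq_integral => w _; rewrite -EFinM (big_rem k kt).
  - by move=> w; rewrite lee_fin.
  - by apply/measurable_EFinP; exact: measurableT_comp.
rewrite muleC -/c cE.
transitivity (\int[pushforward (density_measure P W0 mW) (X k)]_y (g k y)%:E).
  rewrite ge0_integral_pushforward//; first exact/measurable_EFinP.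
  by move=> y _; rewrite lee_fin.
rewrite (eq_measure_integral (mscale r0 (distribution P (X k)))); last first.
  by move=> A mA _; exact: lawk.
rewrite ge0_integral_mscale//; last 2 first.
- exact/measurable_EFinP.
- by move=> y _; rewrite lee_fin.
rewrite ge0_integral_distribution//; first exact/measurable_EFinP.
by move=> y; rewrite lee_fin.
Qed.

(** The expectation is multiplicative on nonnegative integrable functions of
    independent variables. *)
Lemma independent_expectation_prod (t : seq I0) (g : I0 -> R -> R) :
  uniq t -> (forall i, i \in t -> I i) ->
  (forall i x, 0 <= g i x)%R -> (forall i, measurable_fun setT (g i)) ->
  (forall i, i \in t -> \int[P]_w (g i (X i w))%:E < +oo) ->
  \int[P]_w (\prod_(i <- t) g i (X i w))%:E =
  \prod_(i <- t) \int[P]_w (g i (X i w))%:E.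
Proof.
move=> ut tI g0 mg gfin.
by apply: (@independent_prod_indic t) => // i it; rewrite it.
Qed.

End independent_product.

(** * Translating and tilting the normal law *)

Section normal.
Context (R : realType).
Implicit Types (c m s v x : R) (A : set R).
Local Notation leb := (@lebesgue_measure R).

(** The translation [x |-> x + c], as a map of the measurable space on which
    the Lebesgue measure is defined. *)
Definition translation c : measurableTypeR R -> measurableTypeR R :=
  fun x => x + c.

Let measurable_translation c : measurable_fun setT (translation c).
Proof. exact: measurable_funD. Qed.

HB.instance Definition _ c := isMeasurableFun.Build _ _ _ _
  (translation c) (@measurable_translation c).

Lemma lebesgue_measure_translation c A : measurable A ->
  pushforward leb (translation c) A = leb A.
Proof.
move=> mA; apply/esym.
apply: (lebesgue_measure_unique (mu := pushforward leb (translation c))) => // X.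
rewrite /ocitv => -[[a b] /= _ <-].
rewrite /pushforward.
rewrite (_ : translation c @^-1` _ = (`]a - c, b - c])%classic); last first.
  by apply/seteqP; split => x /=; rewrite !in_itv/= /translation ltrBlDr lerBrDr.
by rewrite !lebesgue_measure_itv/= !lte_fin ltrD2r -!EFinB opprB addrA subrK.
Qed.

Lemma normal_prob_translation c s A : s != 0 -> measurable A ->
  normal_prob 0 s (translation c @^-1` A) = normal_prob c s A.
Proof.
move=> s0 mA.
transitivity (\int[leb]_(x in translation c @^-1` A)
    ((EFin \o normal_pdf c s) \o translation c) x)%E.
  apply: eq_integral => x _ /=.
  by rewrite !normal_pdfE// /normal_fun /translation addrK subr0.
rewrite -ge0_integral_pushforward//.
- apply: eq_measure_integral => B mB _; exact: lebesgue_measure_translation.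
- by apply/measurable_EFinP/measurable_funTS; exact: measurable_normal_pdf.
- by move=> x _; rewrite lee_fin normal_pdf_ge0.
Qed.

(** The law of a normal variable integrates nonnegative functions through its
    Lebesgue density. *)
Lemma ge0_integral_normal_law d (T : measurableType d) (P : probability T R)
    (X : {RV P >-> R}) m s (f : R -> \bar R) :
  (forall A, measurable A -> distribution P X A = normal_prob m s A) ->
  (forall x, (0 <= f x)%E) -> measurable_fun setT f ->
  (\int[P]_w f (X w) = \int[leb]_x (f x * (normal_pdf m s x)%:E))%E.
Proof.
move=> lawX f0 mf.
pose Y : T -> measurableTypeR R := X.
have mY : measurable_fun setT Y by exact: (measurable_funP X).
pose Y_mixin := isMeasurableFun.Build _ _ _ _ _ mY.
pose Y_pack : {mfun _ >-> _} := HB.pack Y Y_mixin.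
pose g : measurableTypeR R -> \bar R := f.
have mg : measurable_fun setT g by exact: mf.
pose nu := density_measure leb (normal_pdf_ge0 m s) (measurable_normal_pdf m s).
transitivity (\int[nu]_x g x)%E; last first.
  exact: (ge0_integral_density leb _ _ f0 mg).
transitivity (\int[pushforward P Y_pack]_x g x)%E.
  rewrite ge0_integral_pushforward//.
apply: (eq_measure_integral (density_measure leb (normal_pdf_ge0 m s)
  (measurable_normal_pdf m s))) => A mA _.
exact: lawX.
Qed.

(** Completing the square: the exponential weight [exp (v x - v^2 s^2 / 2)]
    moves the mean of the normal law from [0] to [v s^2]. *)
Lemma normal_pdf_tilt v s x : s != 0 ->
  expR (v * x - v ^+ 2 * s ^+ 2 / 2) * normal_pdf 0 s x =
  normal_pdf (v * s ^+ 2) s x.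
Proof.
move=> s0.
have pdfE m : normal_pdf m s x = normal_peak s * normal_fun m s x.
  by rewrite normal_pdfE.
rewrite !pdfE mulrCA /normal_fun -expRD; congr (_ * expR _).
by rewrite -mulr_natr; field.
Qed.

Lemma normal_law_tilt d (T : measurableType d) (P : probability T R)
    (X : {RV P >-> R}) v s A :
  s != 0 -> measurable A ->
  (forall B, measurable B -> distribution P X B = normal_prob 0 s B) ->
  (\int[P]_w (\1_A (X w) * expR (v * X w - v ^+ 2 * s ^+ 2 / 2))%:E =
   P [set w | A (X w + v * s ^+ 2)%R])%E.
Proof.
move=> s0 mA lawX.
pose B : set R := (fun x => x + v * s ^+ 2) @^-1` A.
have mB : measurable B.
  by rewrite -[B]setTI; apply: measurable_funD mA.
transitivity (distribution P X B) => //.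
rewrite lawX// (normal_prob_translation _ s0 mA).
pose f x := (\1_A x * expR (v * x - v ^+ 2 * s ^+ 2 / 2))%:E.
rewrite (@ge0_integral_normal_law _ _ _ X 0 s f lawX).
- rewrite /normal_prob [RHS]integral_mkcond; apply: eq_integral => x _.
  rewrite epatch_indic /f /= -(normal_pdf_tilt v x s0) -!EFinM; congr EFin.
  by ring.
- by move=> x; rewrite lee_fin mulr_ge0// expR_ge0.
- apply/measurable_EFinP/measurable_funM; first exact: measurable_indic.
  by apply: measurableT_comp => //; apply: measurable_funB.
Qed.

End normal.

(** * The Cameron-Martin formula for independent normal variables *)

Section rectangles.
Context d (T : measurableType d) (m : nat).

(** The measurable rectangles of [T^m]. *)
Definition rectangles : set (set (m.-tuple T)) :=
  [set B | exists2 A : 'I_m -> set T, forall i, measurable (A i) &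
    B = [set x | forall i, A i (tnth x i)]].

Lemma measurable_rectangles : rectangles `<=` measurable.
Proof.
move=> _ [A mA ->].
rewrite (_ : [set x | _] = \bigcap_(i in setT) (@tnth _ T ^~ i @^-1` A i)).
  apply: fin_bigcap_measurable => // i _.
  by rewrite -[_ @^-1` _]setTI; exact: measurable_tnth.
by apply/seteqP; split => x /= Ax i; [move=> _|]; exact: Ax.
Qed.

Lemma measurable_tuple_rectangles :
  measurable = <<s rectangles >> :> set (set (m.-tuple T)).
Proof.
apply/seteqP; split; last first.
  apply: smallest_sub; first exact: sigma_algebra_measurable.
  exact: measurable_rectangles.
pose f : g_sigma_algebraType rectangles -> m.-tuple T := id.
have mf : measurable_fun setT f.
  apply/measurable_fun_tnthP => i _ A mA; rewrite setTI.
  apply: sub_sigma_algebra; exists (fun j => if j == i then A else setT).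
    by move=> j; case: ifP.
  apply/seteqP; split => x /=; last by move=> /(_ i); rewrite eqxx.
  by move=> Axi j; case: eqP => [->|].
by move=> A mA; have := mf measurableT A mA; rewrite setTI.
Qed.

Lemma setI_closed_rectangles : setI_closed rectangles.
Proof.
move=> _ _ [A mA ->] [B mB ->]; exists (fun i => A i `&` B i).
  by move=> i; exact: measurableI.
apply/seteqP; split => x /=; first by move=> [Ax Bx] i; split.
by move=> ABx; split => i; have [] := ABx i.
Qed.

Lemma measure_rectangles_unique (R : realType)
    (mu nu : {measure set (m.-tuple T) -> \bar R}) :
  (mu setT < +oo)%E -> (forall A, rectangles A -> mu A = nu A) ->
  forall A, measurable A -> mu A = nu A.
Proof.
move=> muT munu.
apply: (measure_unique rectangles (fun=> setT)) => //.
- exact: measurable_tuple_rectangles.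
- exact: setI_closed_rectangles.
- by move=> _; exists (fun=> setT) => //; apply/seteqP; split.
- by rewrite bigcup_const.
Qed.

End rectangles.

Lemma measurable_fun_mktuple d d' (T : measurableType d)
    (T' : measurableType d') m (Y : 'I_m -> T -> T') :
  (forall i, measurable_fun setT (Y i)) ->
  measurable_fun setT (fun w => [tuple Y i w | i < m]).
Proof.
move=> mY; apply/measurable_fun_tnthP => i.
rewrite (_ : _ \o _ = Y i)//.
by apply/funext => w /=; rewrite tnth_mktuple.
Qed.

Section cameron_martin.
Context d (T : measurableType d) (R : realType) (P : probability T R).
Context (m : nat) (X : 'I_m -> {RV P >-> R}) (s : 'I_m -> R).
Hypotheses (s_neq0 : forall i, s i != 0) (indepX : independent_RVs setT X).
Hypothesis lawX : forall i (A : set R), measurable A ->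
  distribution P (X i) A = normal_prob 0 (s i) A.
Implicit Types v : 'I_m -> R.

(** The linear form [sum_i v_i X_i], and its variance. *)
Definition linform v (w : T) : R := \sum_i v i * X i w.

Definition linvar v : R := \sum_i v i ^+ 2 * s i ^+ 2.

Lemma measurable_linform v : measurable_fun setT (linform v).
Proof.
by apply: measurable_sum => i; exact: measurable_funM.
Qed.

(** The exponential weight normalised to have expectation [1]. *)
Definition tilt v (w : T) : R := expR (linform v w - linvar v / 2).

Lemma tilt_ge0 v w : 0 <= tilt v w. Proof. exact: expR_ge0. Qed.

Lemma measurable_tilt v : measurable_fun setT (tilt v).
Proof.
by apply: measurableT_comp => //; apply: measurable_funB => //;
  exact: measurable_linform.
Qed.

Lemma tiltE v w :
  tilt v w = \prod_i expR (v i * X i w - v i ^+ 2 * s i ^+ 2 / 2).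
Proof. by rewrite -expR_sum sumrB -mulr_suml. Qed.

(** On rectangles, the formula is the product of the one-dimensional ones. *)
Let tilt_rectangle v (A : 'I_m -> set R) : (forall i, measurable (A i)) ->
  (\int[P]_(w in [set w | forall i, A i (X i w)]) (tilt v w)%:E =
   P [set w | forall i, A i (X i w + v i * s i ^+ 2)%R])%E.
Proof.
move=> mA.
pose g i x : R := \1_(A i) x * expR (v i * x - v i ^+ 2 * s i ^+ 2 / 2).
pose B i : set R := [set x | A i (x + v i * s i ^+ 2)].
have mB i : measurable (B i).
  by rewrite -[B i]setTI; apply: measurable_funD (mA i).
have gi i : (\int[P]_w (g i (X i w))%:E = P (X i @^-1` B i))%E.
  by rewrite (normal_law_tilt _ (s_neq0 i) (mA i) (@lawX i)).
transitivity (\int[P]_w (\prod_(i <- index_enum 'I_m) g i (X i w))%:E)%E.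
  rewrite integral_mkcond; apply: eq_integral => w _.
  rewrite epatch_indic/= -EFinM; congr EFin.
  rewrite big_split/= -tiltE mulrC; congr (_ * _).
  rewrite indicE; case: (boolP (w \in _)) => [/set_mem/= Aw|Aw].
    by rewrite big1// => i _; rewrite indicE mem_set.
  have [i Ai] : exists i, ~ A i (X i w).
    apply/existsNP => Aw'; move: Aw; apply/negP; rewrite negbK.
    by apply/mem_set.
  by rewrite (bigD1 i)//= indicE memNset// mul0r.
rewrite (independent_expectation_prod indepX) ?index_enum_uniq//.
- under eq_bigr do rewrite gi.
  rewrite -(indepX (index_enum_uniq _) _ (fun i _ => mB i))//; congr (P _).
  apply/seteqP; split => w /=; last by move=> Aw i _; exact: Aw.
  by move=> Aw i; apply: Aw; exact: mem_index_enum.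
- by move=> i x; rewrite mulr_ge0// expR_ge0.
- move=> i; apply: measurable_funM; first exact: measurable_indic.
  by apply: measurableT_comp => //; apply: measurable_funB.
- move=> i _; rewrite gi; apply: le_lt_trans (ltry 1).
  by apply: probability_le1; rewrite -[_ @^-1` _]setTI; exact: measurable_funP.
Qed.

(** Weighting the law of [X] by the exponential of the linear form [v] amounts
    to translating [X] by the covariances [v_i s_i^2] of the [X_i] with the form. *)
Theorem cameron_martin v (h : m.-tuple R -> \bar R) :
  (forall x, (0 <= h x)%E) -> measurable_fun setT h ->
  (\int[P]_w (h [tuple X i w | i < m] * (tilt v w)%:E) =
   \int[P]_w h [tuple (X i w + v i * s i ^+ 2)%R | i < m])%E.
Proof.
move=> h0 mh.
pose X0 w := [tuple X i w | i < m].
pose X1 w := [tuple X i w + v i * s i ^+ 2 | i < m].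
have mX0 : measurable_fun setT X0 by exact: measurable_fun_mktuple.
have mX1 : measurable_fun setT X1.
  by apply: measurable_fun_mktuple => i; exact: measurable_funD.
pose X0' : {mfun T >-> m.-tuple R} :=
  HB.pack X0 (isMeasurableFun.Build _ _ _ _ _ mX0).
pose X1' : {mfun T >-> m.-tuple R} :=
  HB.pack X1 (isMeasurableFun.Build _ _ _ _ _ mX1).
pose Q := density_measure P (tilt_ge0 v) (measurable_tilt v).
transitivity (\int[Q]_w h (X0 w))%E.
  by rewrite ge0_integral_density//; exact: measurableT_comp.
transitivity (\int[pushforward Q X0']_x h x)%E.
  by rewrite ge0_integral_pushforward.
transitivity (\int[pushforward P X1']_x h x)%E; last first.
  by rewrite ge0_integral_pushforward.
apply: eq_measure_integral => A mA _; apply/esym; move: A mA.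
apply: measure_rectangles_unique.
  exact: le_lt_trans (probability_le1 P measurableT) (ltry _).
move=> _ [A mA ->].
have X0A : X0 @^-1` [set x | forall i, A i (tnth x i)] =
    [set w | forall i, A i (X i w)].
  by apply/seteqP; split => w /= + i => /(_ i); rewrite tnth_mktuple.
have X1A : X1 @^-1` [set x | forall i, A i (tnth x i)] =
    [set w | forall i, A i (X i w + v i * s i ^+ 2)].
  by apply/seteqP; split => w /= + i => /(_ i); rewrite tnth_mktuple.
transitivity (P (X1 @^-1` [set x | forall i, A i (tnth x i)])) => //.
by rewrite X1A -tilt_rectangle// -X0A.
Qed.

End cameron_martin.

(** * From exponential weights to linear ones *)

Section exponential_weight.
Context d (T : measurableType d) (R : realType) (P : probability T R).
Variables (D : T -> R) (mD : measurable_fun setT D).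
Hypothesis expD : forall a,
  P.-integrable setT (fun w => (expR (a * D w))%:E).

Lemma ler_norm_expR (x t : R) : 0 <= t <= 1 ->
  `|x| * expR (t * x) <= expR (2 * x) + expR (- 2 * x).
Proof.
move=> /andP[t0 t1].
have x1 : `|x| <= expR `|x| by rewrite (le_trans _ (expR_ge1Dx _))// lerDr.
have x2 : expR (t * x) <= expR `|x|.
  rewrite ler_expR (le_trans (ler_norm _))// normrM (ger0_norm t0).
  by rewrite ler_piMl.
apply: (@le_trans _ _ (expR (2 * `|x|))).
  by rewrite mulr_natl mulr2n expRD ler_pM// expR_ge0.
have [x0|x0] := ger0P x; first by rewrite lerDl expR_ge0.
by rewrite mulrN mulNr lerDr expR_ge0.
Qed.

Let dom w := expR (2 * D w) + expR (- 2 * D w).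

Let dom_ge0 w : 0 <= dom w. Proof. by rewrite addr_ge0// expR_ge0. Qed.

Let integrable_dom : P.-integrable setT (EFin \o dom).
Proof. by apply: (integrableD _ (expD 2) (expD (- 2))). Qed.

Lemma integrable_exponential_moments : P.-integrable setT (EFin \o D).
Proof.
apply: le_integrable integrable_dom => //=; first exact/measurable_EFinP.
move=> w _; rewrite lee_fin (ger0_norm (dom_ge0 w)).
have := @ler_norm_expR (D w) 0; rewrite mul0r expR0 mulr1; apply.
by rewrite lexx ler01.
Qed.

Variables (G : T -> R) (K : R) (mG : measurable_fun setT G).
Hypothesis GK : forall w, `|G w| <= K.

Lemma integrable_bounded_weight t : 0 <= t <= 1 ->
  P.-integrable setT (fun w => (D w * expR (t * D w) * G w)%:E).
Proof.
move=> t01.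
have Kdom : P.-integrable setT (EFin \o (fun w => K * dom w)).
  exact: (integrableZl _ K integrable_dom).
apply: le_integrable Kdom => //=.
  apply/measurable_EFinP; apply: measurable_funM => //.
  apply: measurable_funM => //; apply: measurableT_comp => //.
  exact: measurable_funM.
move=> w _; have K0 : 0 <= K by rewrite (le_trans _ (GK w)).
rewrite lee_fin !normrM (ger0_norm K0) (ger0_norm (expR_ge0 _)) mulrC.
rewrite ler_pM// ?mulr_ge0 ?expR_ge0//.
by rewrite (ger0_norm (dom_ge0 w)) ler_norm_expR.
Qed.

Lemma integrable_bounded_mul :
  P.-integrable setT (fun w => (D w * G w)%:E).
Proof.
have := @integrable_bounded_weight 0; rewrite lexx ler01 => /(_ isT).
by under eq_fun do rewrite mul0r expR0 mulr1.
Qed.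

(** If the weights [exp (t D)], [t > 0], all increase the expectation of
    the bounded variable [G >= 0], then [D] and [G] have nonnegative mixed
    moment: since [exp u - 1 <= u exp u], the expectation of
    [D exp (t D) G] is nonnegative, and [t] tends to [0]. *)
Lemma expectation_mul_ge0 : (forall w, 0 <= G w) ->
  (forall t, 0 < t -> (\int[P]_w (G w)%:E <=
     \int[P]_w (G w * expR (t * D w))%:E)%E) ->
  (0 <= \int[P]_w (D w * G w)%:E)%E.
Proof.
move=> G0 Gexp.
pose u n : R := n.+1%:R^-1.
have u01 n : 0 <= u n <= 1.
  by rewrite invr_ge0 ler0n /= invf_le1// ler1n.
pose h n w := (D w * expR (u n * D w) * G w)%:E.
have intG : P.-integrable setT (EFin \o G).
  apply: (@le_integrable _ _ _ P _ measurableT _ (cst K%:E)) => //.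
  - exact/measurable_EFinP.
  - move=> w _ /=; rewrite lee_fin.
    by rewrite (ger0_norm (le_trans (normr_ge0 _) (GK w))).
  - exact: finite_measure_integrable_cst.
have h_ge0 n : (0 <= \int[P]_w h n w)%E.
  have t0 : 0 < u n by rewrite invr_gt0.
  have : (0 <= \int[P]_w ((u n)%:E * h n w))%E.
    have intGe : P.-integrable setT (fun w => (G w * expR (u n * D w))%:E).
      apply: le_integrable (integrableZl measurableT K (expD (u n))) => //=.
        apply/measurable_EFinP; apply: measurable_funM => //.
        by apply: measurableT_comp => //; exact: measurable_funM.
      move=> w _; rewrite lee_fin !normrM ler_pM//.
      exact: le_trans (GK w) (ler_norm _).
    have : (0 <= \int[P]_w ((G w * expR (u n * D w))%:E - (G w)%:E))%E.
      rewrite integralB_EFin// sube_ge0 ?Gexp//.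
      by apply/orP; left; exact: integrable_fin_num.
    move=> /le_trans; apply; apply: le_integral => //.
    - exact: integrableB.
    - apply: integrableZl => //; exact: integrable_bounded_weight.
    - move=> w _; rewrite -EFinB -EFinM lee_fin.
      have e1 : expR (u n * D w) - 1 <= u n * D w * expR (u n * D w).
        have := expR_ge1Dx (- (u n * D w)).
        rewrite -(ler_pM2r (expR_gt0 (u n * D w))) -expRD addNr expR0 mulrDl.
        by rewrite mul1r mulNr => ?; lra.
      rewrite (_ : _ - G w = G w * (expR (u n * D w) - 1)); last by ring.
      rewrite [leRHS](_ : _ = G w * (u n * D w * expR (u n * D w))).
        by rewrite ler_wpM2l.
      by ring.
  rewrite integralZl//; last exact: integrable_bounded_weight.
  by rewrite pmule_rge0// lte_fin.
have [_ _ hcvg] : [/\ P.-integrable setT (fun w => (D w * G w)%:E),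
    [sequence \int[P]_w `|h n w - (D w * G w)%:E|]_n @ \oo --> 0%E &
    [sequence \int[P]_w h n w]_n @ \oo --> \int[P]_w (D w * G w)%:E]%E.
  apply: (@dominated_convergence _ _ _ P setT measurableT h _
     (fun w => (K * dom w)%:E)).
  - by move=> n; exact: measurable_int (integrable_bounded_weight (u01 n)).
  - exact: measurable_int integrable_bounded_mul.
  - apply: aeW => w _; apply/fine_cvgP; split; first by near=> n.
    rewrite (_ : D w * G w = D w * 1 * G w); last by rewrite mulr1.
    apply: cvgMl => //; apply: cvgMr => //; rewrite -expR0.
    apply: continuous_cvg; first exact: continuous_expR.
    rewrite -(mul0r (D w)); apply: cvgMl => //; exact: cvg_harmonic.
  - exact: (integrableZl _ K integrable_dom).
  - apply: aeW => w n _; rewrite /h lee_fin.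
    have K0 : 0 <= K by rewrite (le_trans _ (GK w)).
    rewrite !normrM (ger0_norm (expR_ge0 _)) mulrC.
    by rewrite ler_pM// ?mulr_ge0 ?expR_ge0// ler_norm_expR.
rewrite -(cvg_lim _ hcvg)//; apply: lime_ge.
  by apply/cvg_ex; eexists; exact: hcvg.
by apply: nearW => n /=.
Unshelve. all: by end_near. Qed.

End exponential_weight.

(** * Truncation *)

Section truncation.
Context (R : realType).
Implicit Types (x y d : R) (n : nat).

(** [y] truncated to the interval [[-n, n]]. *)
Definition truncate n y := Num.max (- n%:R) (Num.min n%:R y).

Lemma le_truncate n : {homo truncate n : x y / x <= y}.
Proof.
by move=> x y xy; rewrite /truncate le_max2 ?le_min2.
Qed.

Lemma truncate_norm n y : `|truncate n y| <= n%:R.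
Proof.
have n0 : 0 <= n%:R :> R by [].
rewrite /truncate ler_norml; apply/andP; split.
  by rewrite le_max lexx.
by rewrite ge_max ge_min lexx andbT/=; lra.
Qed.

Lemma truncateE n y : `|y| <= n%:R -> truncate n y = y.
Proof.
rewrite ler_norml => /andP[y1 y2].
by rewrite /truncate (min_idPr y2) (max_idPr y1).
Qed.

Lemma measurable_truncate n : measurable_fun setT (truncate n).
Proof. by apply: measurable_maxr => //; exact: measurable_minr. Qed.

(** Truncating at a lower level moves the value towards [0]. *)
Lemma truncate_shrink m n y : (m <= n)%N ->
  0 <= truncate m y <= truncate n y \/ truncate n y <= truncate m y <= 0.
Proof.
rewrite -(ler_nat R) => mn.
have [y0|y0] := leP 0 y; [left|right].
  have E k : truncate k y = Num.min k%:R y.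
    have k0 : - k%:R <= 0 :> R by rewrite oppr_le0.
    by apply/max_idPr; rewrite le_min (le_trans k0)// (le_trans k0).
  by rewrite !E le_min ler0n y0 le_min2.
have E k : truncate k y = Num.max (- k%:R) y.
  by rewrite /truncate (min_idPr (le_trans (ltW y0) _)).
by rewrite !E le_max2 ?lerN2// ge_max oppr_le0 ler0n (ltW y0).
Qed.

Lemma truncate_shrink_id n y :
  0 <= truncate n y <= y \/ y <= truncate n y <= 0.
Proof.
have [N nN yN] : exists2 N, (n <= N)%N & `|y| <= N%:R.
  exists (maxn n (Num.truncn `|y|).+1); first exact: leq_maxl.
  rewrite (le_trans (ltW (truncnS_gt _)))// ler_nat leq_maxr//.
have := truncate_shrink y nN; by rewrite (truncateE yN).
Qed.

Lemma max_mul_shrink d x y : 0 <= x <= y \/ y <= x <= 0 ->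
  Num.max (d * x) 0 <= Num.max (d * y) 0.
Proof.
move=> xy; rewrite ge_max !le_max lexx orbT andbT.
have [d0|d0] := leP 0 d; case: xy => /andP[h1 h2].
- by rewrite ler_wpM2l.
- by apply/orP; right; rewrite mulr_ge0_le0.
- by apply/orP; right; rewrite mulr_le0_ge0// ltW.
- by rewrite ler_wnM2l// ltW.
Qed.

End truncation.

Section truncated_expectation.
Context d (T : measurableType d) (R : realType) (P : probability T R).
Variables (D F : T -> R).
Hypotheses (mD : measurable_fun setT D) (mF : measurable_fun setT F).

Let F_ n w := truncate n (F w).

Let mF_ n : measurable_fun setT (F_ n).
Proof. exact: measurableT_comp (measurable_truncate n) mF. Qed.

(** If all truncations of [F] have nonnegative mixed moment with [D], then so
    has [F], as soon as the expectation exists: the expectation of the negative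
    part of [D F] is at most that of its positive part. *)
Lemma expectation_truncate_ge0 :
  (forall n, P.-integrable setT (fun w => (D w * F_ n w)%:E)) ->
  (forall n, (0 <= \int[P]_w (D w * F_ n w)%:E)%E) ->
  expectation_defined P (fun w => D w * F w) ->
  (0 <= 'E_P[fun w => (D w * F w)%R])%E.
Proof.
move=> intDF DF_ge0.
pose X w := D w * F w; pose X_ n w := D w * F_ n w.
have mX : measurable_fun setT X by exact: measurable_funM.
have mX_ n : measurable_fun setT (X_ n) by exact: measurable_funM.
have splitE (Y : T -> R) : (\int[P]_w (Y w)%:E =
    \int[P]_w (Y^\+ w)%:E - \int[P]_w (Y^\- w)%:E)%E.
  by rewrite integralE funerpos funerneg.
have mpos (Y : T -> R) : measurable_fun setT Y ->
    measurable_fun setT (EFin \o Y^\+).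
  by move=> mY; apply/measurable_EFinP; exact: measurable_funrpos.
have mneg (Y : T -> R) : measurable_fun setT Y ->
    measurable_fun setT (EFin \o Y^\-).
  by move=> mY; apply/measurable_EFinP; exact: measurable_funrneg.
have neg_le_pos n :
    (\int[P]_w ((X_ n)^\- w)%:E <= \int[P]_w (X^\+ w)%:E)%E.
  apply: (@le_trans _ _ (\int[P]_w ((X_ n)^\+ w)%:E)%E).
    have := DF_ge0 n; rewrite splitE sube_ge0//.
    apply/orP; left; have := integrable_neg_fin_num measurableT (intDF n).
    by rewrite -[fun w => (D w * F_ n w)%:E]/(EFin \o X_ n) funerneg.
  apply: ge0_le_integral => //.
  - by move=> w _; rewrite lee_fin.
  - exact: mpos (mX_ n).
  - exact: mpos mX.
  - move=> w _; rewrite lee_fin; apply: max_mul_shrink.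
    exact: truncate_shrink_id.
have neg_pos : (\int[P]_w (X^\- w)%:E <= \int[P]_w (X^\+ w)%:E)%E.
  have cvX : (fun n => \int[P]_w ((X_ n)^\- w)%:E)%E @ \oo -->
      (\int[P]_w (X^\- w)%:E)%E.
    have -> : (\int[P]_w (X^\- w)%:E =
        \int[P]_w limn (fun n => ((X_ n)^\- w)%:E))%E.
      apply: eq_integral => w _; apply/esym/cvg_lim => //.
      apply: cvg_near_cst; near=> n.
      rewrite /X_ /F_ /funrneg truncateE//.
      by near: n; exact: nbhs_infty_ger.
    apply: cvg_monotone_convergence => //.
    - by move=> n; exact: mneg (mX_ n).
    - by move=> n w _; rewrite lee_fin.
    - move=> w _ m n mn; rewrite lee_fin /funrneg -!mulNr.
      by apply: max_mul_shrink; exact: truncate_shrink.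
  rewrite -(cvg_lim _ cvX)//; apply: lime_le.
    by apply/cvg_ex; eexists; exact: cvX.
  by apply: nearW => n /=.
rewrite /expectation_defined !unlock => Xdef.
rewrite splitE sube_ge0//.
case: Xdef => Xfin; apply/orP; [right|left];
  by rewrite ge0_fin_numE// integral_ge0// => w _; rewrite lee_fin.
Unshelve. all: by end_near. Qed.

End truncated_expectation.

(** * Functions increasing along the covariances with a linear form *)

Section gaussian_association.
Context d (T : measurableType d) (R : realType) (P : probability T R).
Context (m : nat) (X : 'I_m -> {RV P >-> R}) (s : 'I_m -> R).
Hypotheses (s_neq0 : forall i, s i != 0) (indepX : independent_RVs setT X).
Hypothesis lawX : forall i (A : set R), measurable A ->
  distribution P (X i) A = normal_prob 0 (s i) A.
Implicit Types v : 'I_m -> R.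

Local Notation linform := (linform X).
Local Notation linvar := (linvar s).
Local Notation tilt := (tilt X s).

Let X0 w := [tuple X i w | i < m].

Let mX0 : measurable_fun setT X0.
Proof. exact: measurable_fun_mktuple. Qed.

Lemma linformZ a v w : linform (fun i => a * v i) w = a * linform v w.
Proof. by rewrite /linform mulr_sumr; apply: eq_bigr => i _; rewrite mulrA. Qed.

Lemma linvar_ge0 v : 0 <= linvar v.
Proof. by apply: sumr_ge0 => i _; rewrite mulr_ge0 ?sqr_ge0. Qed.

Lemma integral_tilt v : (\int[P]_w (tilt v w)%:E = 1)%E.
Proof.
have := @cameron_martin _ _ _ _ _ _ _ s_neq0 indepX lawX v (cst 1%E).
under eq_integral do rewrite mul1e.
by move=> ->//; rewrite integral_cst// mul1e; exact: probability_setT.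
Qed.

Lemma integrable_expR_linform v a :
  P.-integrable setT (fun w => (expR (a * linform v w))%:E).
Proof.
pose av i := a * v i.
have it : P.-integrable setT (EFin \o tilt av).
  apply/integrableP; split; first exact/measurable_EFinP/measurable_tilt.
  under eq_integral do rewrite gee0_abs ?lee_fin ?tilt_ge0//.
  by rewrite integral_tilt ltry.
rewrite (_ : (fun w => _) =
    (fun w => (expR (linvar av / 2))%:E * (EFin \o tilt av) w)%E).
  exact: integrableZl.
apply/funext => w; rewrite /= -EFinM -expRD linformZ; congr (expR _)%:E.
by rewrite addrC subrK.
Qed.

Lemma integrable_linform v : P.-integrable setT (EFin \o linform v).
Proof.
apply: integrable_exponential_moments; first exact: measurable_linform.
exact: integrable_expR_linform.
Qed.

(** The vector of the covariances of the [X_i] with the linear form [v]. *)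
Let cov v i := v i * s i ^+ 2.

(** [F] is nondecreasing on every half-line with direction [c]. *)
Definition nondecreasing_along (c : 'I_m -> R) (F : m.-tuple R -> R) : Prop :=
  forall x t, 0 <= t -> F x <= F [tuple tnth x i + t * c i | i < m].

(** The case of a bounded function with values in [[0, K]]. *)
Let ge0_bounded v (G : m.-tuple R -> R) K :
  measurable_fun setT G -> (forall x, 0 <= G x <= K) ->
  nondecreasing_along (cov v) G ->
  (0 <= \int[P]_w (linform v w * G (X0 w))%:E)%E.
Proof.
move=> mG GK ndG.
have G0 x : 0 <= G x by have /andP[] := GK x.
have mGX : measurable_fun setT (G \o X0) by exact: measurableT_comp.
apply: (@expectation_mul_ge0 _ _ _ P (linform v) _ _ (G \o X0) K) => //.
- exact: measurable_linform.
- exact: integrable_expR_linform.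
- by move=> w /=; rewrite ger0_norm//; have /andP[] := GK (X0 w).
- by move=> w /=.
move=> t t0; pose tv i := t * v i.
apply: (@le_trans _ _ (\int[P]_w (G (X0 w) * tilt tv w)%:E)%E).
  rewrite [leRHS](_ : _ = \int[P]_w
      (G [tuple (X i w + tv i * s i ^+ 2)%R | i < m])%:E)%E.
    apply: ge0_le_integral => //.
    - by move=> w _; rewrite lee_fin /=.
    - exact/measurable_EFinP.
    - apply/measurable_EFinP; apply: measurableT_comp => //.
      by apply: measurable_fun_mktuple => i; exact: measurable_funD.
    - move=> w _; rewrite lee_fin /=.
      have := ndG (X0 w) t (ltW t0); congr (_ <= G _).
      by apply: eq_from_tnth => i; rewrite !tnth_mktuple /tv mulrA.
  rewrite -(cameron_martin s_neq0 indepX lawX tv (h := EFin \o G))//.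
  exact/measurable_EFinP.
apply: ge0_le_integral => //.
- by move=> w _; rewrite lee_fin mulr_ge0// tilt_ge0.
- apply/measurable_EFinP; apply: measurable_funM => //.
  exact: measurable_tilt.
- by apply/measurable_EFinP; apply: measurable_funM => //;
    apply: measurableT_comp => //; apply: measurable_funM => //;
    exact: measurable_linform.
- move=> w _; rewrite lee_fin ler_wpM2l// ler_expR linformZ.
  by rewrite gerBl divr_ge0// linvar_ge0.
Qed.

Lemma integral_linform v : (\int[P]_w (linform v w)%:E = 0)%E.
Proof.
have ge0 u : (0 <= \int[P]_w (linform u w)%:E)%E.
  have := @ge0_bounded u (cst 1) 1 (@measurable_cst _ _ _ _ setT _).
  under eq_integral do rewrite mulr1.
  by apply => [x|x t _]; rewrite ?ler01 /=.
have neg : (\int[P]_w (linform (fun i => -1 * v i) w)%:E =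
    -1%:E * \int[P]_w (linform v w)%:E)%E.
  under eq_integral do rewrite linformZ EFinM.
  by rewrite integralZl//; exact: integrable_linform.
have := ge0 (fun i => -1 * v i); rewrite neg mulN1e oppe_ge0 => le0.
by apply/eqP; rewrite eq_le ge0 le0.
Qed.

(** The case of a bounded function of any sign. *)
Let ge0_signed v (F : m.-tuple R -> R) K :
  measurable_fun setT F -> (forall x, `|F x| <= K) ->
  nondecreasing_along (cov v) F ->
  (0 <= \int[P]_w (linform v w * F (X0 w))%:E)%E.
Proof.
move=> mF FK ndF.
have mFX : measurable_fun setT (F \o X0) by exact: measurableT_comp.
have : (0 <= \int[P]_w (linform v w * (F (X0 w) + K))%:E)%E.
  apply: (@ge0_bounded v (fun x => F x + K) (K + K)).
  - exact: measurable_funD.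
  - by move=> x; have := FK x; rewrite ler_norml => /andP[? ?]; lra.
  - by move=> x t t0; rewrite lerD2r; exact: ndF.
under eq_integral do rewrite mulrDr EFinD.
rewrite integralD//=.
- under [X in (_ + X)%E]eq_integral do rewrite mulrC EFinM.
  rewrite integralZl//; last exact: integrable_linform.
  by rewrite integral_linform mule0 adde0.
- apply: (@integrable_bounded_mul _ _ _ P (linform v) _ _ (F \o X0) K) => //.
  + exact: measurable_linform.
  + exact: integrable_expR_linform.
  + by move=> w; exact: FK.
- under eq_fun do rewrite mulrC EFinM.
  by apply: integrableZl => //; exact: integrable_linform.
Qed.

(** A function of the [X_i] that increases when its argument moves along the
    covariances with a linear form has nonnegative covariance with that form. *)
Theorem expectation_linform_mul_ge0 v (F : m.-tuple R -> R) :
  measurable_fun setT F ->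
  nondecreasing_along (fun i => v i * s i ^+ 2) F ->
  let Y w := linform v w * F [tuple X i w | i < m] in
  expectation_defined P Y -> (0 <= 'E_P[Y])%E.
Proof.
move=> mF ndF /=.
have mFX : measurable_fun setT (F \o X0) by exact: measurableT_comp.
apply: (@expectation_truncate_ge0 _ _ _ P (linform v) (F \o X0)) => //.
- exact: measurable_linform.
- move=> n.
  apply: (@integrable_bounded_mul _ _ _ P (linform v) _ _
    (fun w => truncate n (F (X0 w))) n%:R) => //.
  + exact: measurable_linform.
  + exact: integrable_expR_linform.
  + exact: measurableT_comp (measurable_truncate n) mFX.
  + by move=> w; exact: truncate_norm.
- move=> n; apply: (@ge0_signed v (truncate n \o F) n%:R).
  + exact: measurableT_comp (measurable_truncate n) mF.
  + by move=> x; exact: truncate_norm.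
  + by move=> x t t0; apply: le_truncate; exact: ndF.
Qed.

End gaussian_association.

(** * Joining two independent sequences *)

Section join.
Context d (T : measurableType d) (R : realType) (P : probability T R).

(** Independence passes to a family indexed through an injection, given here
    with a left inverse [g]. *)
Lemma independent_RVs_reindex (I0 J0 : choiceType) (I : set I0) (J : set J0)
    (X : I0 -> {RV P >-> R}) (f : J0 -> I0) (g : I0 -> J0) :
  independent_RVs I X -> (forall j, J j -> I (f j)) ->
  (forall j, J j -> g (f j) = j) -> independent_RVs J (X \o f).
Proof.
move=> indepX fI fK t A ut tJ mA.
have fKt : {in t, cancel f g} by move=> j jt; apply: fK; exact: tJ.
have ->  : \bigcap_(j in [set` t]) ((X \o f) j @^-1` A j) =
    \bigcap_(i in [set` map f t]) (X i @^-1` A (g i)).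
  apply/seteqP; split => w /= Aw.
    by move=> i /= /mapP[j jt ->]; rewrite /= fKt//; exact: Aw.
  by move=> j /= jt; have := Aw (f j) (map_f f jt); rewrite /= fKt.
rewrite (indepX (map f t) (A \o g)).
- by rewrite big_map; apply: eq_big_seq => j jt /=; rewrite fKt.
- by rewrite map_inj_in_uniq//; exact: can_in_inj fKt.
- by move=> i /mapP[j jt ->]; apply: fI; exact: tJ.
- by move=> i /mapP[j jt ->] /=; rewrite fKt//; exact: mA.
Qed.

Lemma sigma_RVs_bigcap (I0 J0 : choiceType) (I : set I0)
    (X : I0 -> {RV P >-> R}) (f : J0 -> I0) (t : seq J0) (A : J0 -> set R) :
  (forall j, j \in t -> I (f j)) -> (forall j, j \in t -> measurable (A j)) ->
  sigma_RVs I X (\bigcap_(j in [set` t]) (X (f j) @^-1` A j)).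
Proof.
move=> tI mA; rewrite /sigma_RVs; set G := (G in <<s G >>).
apply: (@fin_bigcap_measurable _ (g_sigma_algebraType G)) => // j jt.
apply: sub_sigma_algebra; exists (f j); first exact: tI.
by exists (A j); [exact: mA|rewrite setTI].
Qed.


(** The vector [(xi_1, ..., xi_n, eps_1, ..., eps_n)]. *)
Definition join_RVs (xi eps : nat -> {RV P >-> R}) n (i : 'I_(n + n)) :
    {RV P >-> R} :=
  match fintype.split i with inl k => xi k.+1 | inr k => eps k.+1 end.

Variables xi eps : nat -> {RV P >-> R}.

Lemma join_RVs_lshift n (k : 'I_n) : join_RVs xi eps (lshift n k) = xi k.+1.
Proof. by rewrite /join_RVs -[lshift n k]/(unsplit (inl k)) unsplitK. Qed.

Lemma join_RVs_rshift n (k : 'I_n) : join_RVs xi eps (rshift n k) = eps k.+1.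
Proof. by rewrite /join_RVs -[rshift n k]/(unsplit (inr k)) unsplitK. Qed.

Hypothesis xi_indep : independent_RVs [set k | (1 <= k)%N] xi.
Hypothesis eps_indep : independent_RVs [set n | (1 <= n)%N] eps.
Hypothesis eps_xi_indep :
  independent_families [set n | (1 <= n)%N] [set k | (1 <= k)%N] eps xi.

Lemma independent_join_RVs n : independent_RVs setT (@join_RVs xi eps n.+1).
Proof.
pose N := n.+1.
pose isl (i : 'I_(N + N)) := (i < N)%N.
pose fl (i : 'I_(N + N)) : nat := i.+1.
pose fr (i : 'I_(N + N)) : nat := (i - N).+1.
have XlE i : isl i -> join_RVs xi eps i = xi (fl i).
  rewrite /isl; case: (split_ordP i) => k -> // _.
  by rewrite join_RVs_lshift.
have XrE i : ~~ isl i -> join_RVs xi eps i = eps (fr i).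
  rewrite /isl; case: (split_ordP i) => k -> // _.
  by rewrite join_RVs_rshift /fr /= addKn.
have indl : independent_RVs [set i | isl i] (xi \o fl).
  apply: (independent_RVs_reindex
    (g := fun k => lshift N (inord k.-1)) xi_indep).
    by [].
  by move=> i /= il; apply/val_inj; rewrite /= inordK.
have indr : independent_RVs [set i | ~~ isl i] (eps \o fr).
  apply: (independent_RVs_reindex
    (g := fun k => rshift N (inord k.-1)) eps_indep).
    by [].
  move=> i /=; rewrite /isl -leqNgt => il; apply/val_inj.
  rewrite /= inordK ?subnKC//.
  by rewrite ltn_subLR.
move=> t A ut _ mA.
pose tl := [seq i <- t | isl i]; pose tr := [seq i <- t | ~~ isl i].
have tlP i : i \in tl -> isl i /\ measurable (A i).
  by rewrite mem_filter => /andP[il it]; split => //; exact: mA.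
have trP i : i \in tr -> ~~ isl i /\ measurable (A i).
  by rewrite mem_filter => /andP[il it]; split => //; exact: mA.
have -> : \bigcap_(i in [set` t]) (join_RVs xi eps i @^-1` A i) =
    \bigcap_(i in [set` tr]) (eps (fr i) @^-1` A i) `&`
    \bigcap_(i in [set` tl]) (xi (fl i) @^-1` A i).
  apply/seteqP; split => w /=.
    move=> Aw; split => i /=; rewrite mem_filter => /andP[il it].
      by rewrite -XrE//; exact: Aw.
    by rewrite -XlE//; exact: Aw.
  move=> [Ar Al] i /= it; have [il|ir] := boolP (isl i).
    by rewrite XlE//; apply: Al; rewrite /= mem_filter il.
  by rewrite XrE//; apply: Ar; rewrite /= mem_filter /= ir.
rewrite eps_xi_indep; last 2 first.
- by apply: sigma_RVs_bigcap => // i /trP[].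
- by apply: sigma_RVs_bigcap => // i /tlP[].
rewrite (bigID isl)/= muleC; congr (_ * _)%E.
  rewrite -big_filter -/tl (indl tl)//; last 3 first.
  - exact: filter_uniq.
  - by move=> i /tlP[].
  - by move=> i /tlP[].
  by apply: eq_big_seq => i /tlP[il _]; rewrite XlE.
rewrite -big_filter -/tr (indr tr)//; last 3 first.
- exact: filter_uniq.
- by move=> i /trP[].
- by move=> i /trP[].
by apply: eq_big_seq => i /trP[il _]; rewrite XrE.
Qed.

End join.

(** * The demimartingale *)

Section noisy_walk.
Context (R : realType) (beta : nat -> R) (sigma1 sigma2 : R) (n : nat).
Hypothesis beta_ge0 : forall i, (1 <= i)%N -> 0 <= beta i.
Hypothesis beta_growth : forall i, (1 <= i)%N ->
  sigma2 ^+ 2 <= (beta i.+1 - beta i) * beta i * i%:R * sigma1 ^+ 2.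
Hypothesis beta_nondecreasing :
  forall i j, (1 <= i)%N -> (i <= j)%N -> beta i <= beta j.

(** The coefficients of [S_(i+1)], for [i < n], in the vector
    [(xi_1, ..., xi_n, eps_1, ..., eps_n)]. *)
Definition walk_coef (i : nat) (l : 'I_(n + n)) : R :=
  match fintype.split l with
  | inl k => if (k < i.+1)%N then beta i.+1 else 0
  | inr k => ((k : nat) == i)%:R
  end.

(** The standard deviations, up to sign, of the components of this vector. *)
Definition walk_sigma (l : 'I_(n + n)) : R :=
  match fintype.split l with inl _ => sigma1 | inr _ => sigma2 end.

Let coefl i k : walk_coef i (lshift n k) = if (k < i.+1)%N then beta i.+1 else 0.
Proof. by rewrite /walk_coef -[lshift n k]/(unsplit (inl k)) unsplitK. Qed.

Let coefr i (k : 'I_n) : walk_coef i (rshift n k) = ((k : nat) == i)%:R.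
Proof. by rewrite /walk_coef -[rshift n k]/(unsplit (inr k)) unsplitK. Qed.

Let sigmal k : walk_sigma (lshift n k) = sigma1.
Proof. by rewrite /walk_sigma -[lshift n k]/(unsplit (inl k)) unsplitK. Qed.

Let sigmar k : walk_sigma (rshift n k) = sigma2.
Proof. by rewrite /walk_sigma -[rshift n k]/(unsplit (inr k)) unsplitK. Qed.

Lemma sum_walk_coef i (u : 'I_(n + n) -> R) (a b : nat -> R) : (i < n)%N ->
  (forall k : 'I_n, u (lshift n k) = a k) ->
  (forall k : 'I_n, u (rshift n k) = b k) ->
  \sum_l walk_coef i l * u l = beta i.+1 * (\sum_(k < i.+1) a k) + b i.
Proof.
move=> i_n ul ur; rewrite big_split_ord/=; congr (_ + _).
  rewrite (big_ord_widen n a i_n) mulr_sumr [RHS]big_mkcond/=.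
  by apply: eq_bigr => k _; rewrite coefl ul; case: ifP => _; rewrite ?mul0r.
rewrite (bigD1 (Ordinal i_n))//= coefr ur eqxx mul1r big1 ?addr0// => k ki.
rewrite coefr (_ : (k : nat) == i = false) ?mul0r//.
by apply: contraNF ki => /eqP ki; apply/eqP/val_inj.
Qed.

(** [Cov (S_(i+1), S_(j+2) - S_(j+1)) >= 0] for [i <= j]: among the noises
    of [S_1, ..., S_(j+1)] the increment involves only that of [S_(j+1)], whose
    contribution [- sigma_2^2] is compensated by the growth of [beta]. *)
Lemma walk_cov_ge0 i j : (i <= j)%N -> (j.+1 < n)%N ->
  0 <= \sum_l walk_coef i l *
    ((walk_coef j.+1 l - walk_coef j l) * walk_sigma l ^+ 2).
Proof.
move=> ij jn; have i_n : (i < n)%N by rewrite (leq_ltn_trans ij)// ltnW.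
pose a k := ((if (k < j.+2)%N then beta j.+2 else 0) -
  (if (k < j.+1)%N then beta j.+1 else 0)) * sigma1 ^+ 2.
pose b k := ((k == j.+1)%:R - (k == j)%:R) * sigma2 ^+ 2.
rewrite (@sum_walk_coef i _ a b)//; last 2 first.
- by move=> k; rewrite !coefl sigmal.
- by move=> k; rewrite !coefr sigmar.
have aE k : (k < i.+1)%N -> a k = (beta j.+2 - beta j.+1) * sigma1 ^+ 2.
  move=> ki; have kj : (k < j.+1)%N by rewrite (leq_trans ki).
  by rewrite /a kj ltnS ltnW.
rewrite (eq_bigr (fun=> (beta j.+2 - beta j.+1) * sigma1 ^+ 2)); last first.
  by move=> k _; rewrite aE.
rewrite sumr_const card_ord /b (ltn_eqF (leq_ltn_trans ij (ltnSn j))).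
have [->|/eqP ij'] := eqVneq i j.
  rewrite /= mulr0n mulr1n sub0r mulN1r subr_ge0.
  have := @beta_growth j.+1 isT; congr (_ <= _).
  by rewrite -[X in _ = _ * X]mulr_natr; ring.
rewrite subrr mul0r addr0 mulr_ge0// ?beta_ge0// mulrn_wge0//.
rewrite mulr_ge0 ?sqr_ge0//.
by rewrite subr_ge0 beta_nondecreasing.
Qed.

End noisy_walk.

Theorem proposition1p8 (d : measure_display) (T : measurableType d)
    (R : realType) (P : probability T R)
    (xi eps : nat -> {RV P >-> R}) (sigma1 sigma2 : R) (beta : nat -> R)
    (M S : nat -> T -> R)
    (sigma1_gt0 : 0 < sigma1 ^+ 2) (sigma2_gt0 : 0 < sigma2 ^+ 2)
    (xi_normal : forall k, (1 <= k)%N -> forall A : set R, measurable A ->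
       distribution P (xi k) A = normal_prob 0 sigma1 A)
    (eps_normal : forall n, (1 <= n)%N -> forall A : set R, measurable A ->
       distribution P (eps n) A = normal_prob 0 sigma2 A)
    (xi_indep : independent_RVs [set k | (1 <= k)%N] xi)
    (eps_indep : independent_RVs [set n | (1 <= n)%N] eps)
    (eps_xi_indep :
       independent_families [set n | (1 <= n)%N] [set k | (1 <= k)%N] eps xi)
    (beta_ge0 : forall n, (1 <= n)%N -> 0 <= beta n)
    (beta_nondecreasing :
       forall m n, (1 <= m)%N -> (m <= n)%N -> beta m <= beta n)
    (beta_growth : forall n, (1 <= n)%N ->
       sigma2 ^+ 2 <= (beta n.+1 - beta n) * beta n * n%:R * sigma1 ^+ 2)
    (M_def : forall n, (1 <= n)%N ->
       forall w, M n w = \sum_(1 <= k < n.+1) xi k w)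
    (S_def : forall n, (1 <= n)%N ->
       forall w, S n w = beta n * M n w + eps n w) :
  demimartingale P S.
Proof.
have s1 : sigma1 != 0 by apply: contraTneq sigma1_gt0 => ->; rewrite expr0n ltxx.
have s2 : sigma2 != 0 by apply: contraTneq sigma2_gt0 => ->; rewrite expr0n ltxx.
have indX n := independent_join_RVs xi_indep eps_indep eps_xi_indep n.
have lawX n i (A : set R) : measurable A ->
    distribution P (@join_RVs _ _ _ P xi eps n i) A =
    normal_prob 0 (walk_sigma sigma1 sigma2 i) A.
  move=> mA; rewrite /join_RVs /walk_sigma; case: fintype.split => k.
    exact: xi_normal.
  exact: eps_normal.
have sX n i : @walk_sigma R sigma1 sigma2 n i != 0.
  by rewrite /walk_sigma; case: fintype.split.
have SE n i w : (i < n)%N ->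
    S i.+1 w = linform (@join_RVs _ _ _ P xi eps n) (walk_coef beta i) w.
  move=> i_n; rewrite /linform.
  rewrite (sum_walk_coef beta (a := fun k => xi k.+1 w)
    (b := fun k => eps k.+1 w) i_n); last 2 first.
  - by move=> k; rewrite join_RVs_lshift.
  - by move=> k; rewrite join_RVs_rshift.
  by rewrite S_def// M_def// big_add1 /= big_mkord.
split=> [[//|n] _|[//|j] _ f mf ndf X].
  (* A finite linear combination of normal variables is integrable. *)
  rewrite (_ : _ \o _ = EFin \o linform (@join_RVs _ _ _ P xi eps n.+1)
    (walk_coef beta n)); last by apply/funext => w /=; rewrite (SE n.+1).
  exact: (integrable_linform (sX n.+1) (indX n) (@lawX n.+1)).
(* The indices are shifted by one: the increment is [S_(j+2) - S_(j+1)]. *)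
pose n := j.+2.
pose v (l : 'I_(n + n)) : R := walk_coef beta j.+1 l - walk_coef beta j l.
pose F (x : (n + n).-tuple R) :=
  f [tuple \sum_l walk_coef beta i l * tnth x l | i < j.+1].
have XE : X = fun w => linform (@join_RVs _ _ _ P xi eps n) v w *
    F [tuple join_RVs xi eps i w | i < n + n].
  apply/funext => w; rewrite /X; congr (_ * _).
    rewrite !(SE n)// /linform -sumrB; apply: eq_bigr => l _.
    by rewrite mulrBl.
  congr f; apply: eq_from_tnth => i; rewrite !tnth_mktuple (SE n)//.
    by apply: eq_bigr => l _; rewrite tnth_mktuple.
  by rewrite ltnS ltnW.
rewrite XE; apply: (expectation_linform_mul_ge0 (sX n) (indX _) (@lawX n)).
  apply: measurableT_comp => //; apply: measurable_fun_mktuple => i.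
  by apply: measurable_sum => l; apply: measurable_funM => //;
    exact: measurable_tnth.
move=> x t t0; apply: ndf => i; rewrite !tnth_mktuple.
under [leRHS]eq_bigr do rewrite tnth_mktuple mulrDr.
rewrite big_split/= lerDl.
under eq_bigr do rewrite mulrCA.
rewrite -mulr_sumr mulr_ge0//.
by apply: walk_cov_ge0 => //; rewrite -ltnS.
Qed.
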